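(* Let $M$ be a loopless matroid of finite rank on a (possibly infinite) ground set $E$, with rank function $r$ and lattice of flats $\mathcal{L}(M)$, and let $L$ be a finite set of lines of $M$. The linear system $$x\geq 0,\qquad a(T)\cdot x\leq r(T)\quad\text{for all } T\in\mathcal{L}(M),$$ in the variables $x\in\mathbb{R}^L$, describing the fractional matching polytope, is half-TDI. That is, for every $w:L\to\mathbb{Z}_{+}$ the dual linear program $$\text{minimize } \sum_{F}y_F\,r(F)\quad\text{subject to}\quad y\geq 0,\ \ \sum_F y_F\,a(F)\geq w,$$ over finitely supported $y\in\mathbb{R}^{\mathcal{L}(M)}$, has an optimal solution $y$ with all entries in $\frac12\mathbb{Z}$.
   Context: A line of $M$ is a subset $l\subseteq E$ with $r(l)\in\{1,2\}$ (lines need not be flats). For $X\subseteq E$, the degree vector $a(X)\in\{0,1,2\}^L$ is defined by $a(X)_l=0$ if $X\cap l=\emptyset$, $a(X)_l=2$ if $l\subseteq X$, and $a(X)_l=1$ otherwise. A vector $x\in\mathbb{R}^L$ is a fractional matching in $(M,L)$ if $x\geq0$ and $a(T)\cdot x\leq r(T)$ for every flat $T$ of $M$; the set of these is the fractional matching polytope. *)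

(* Defs.v *)
From mathcomp Require Import all_boot all_order all_algebra.
From mathcomp Require Import finmap.
From mathcomp Require Import boolp classical_sets cardinality reals.

Set Implicit Arguments.
Unset Strict Implicit.
Unset Printing Implicit Defensive.

Import Order.TTheory GRing.Theory Num.Theory.
Local Open Scope classical_set_scope.
Local Open Scope ring_scope.

(* Matroids of finite rank on an arbitrary, possibly infinite, ground set [E],
   given by their rank function; the independent sets are the finite [X] with
   [rank X] equal to the cardinality of [X].  On an infinite ground set the
   first three axioms do not suffice (they hold when [rank X] is 0 for finite
   [X] and 1 for infinite [X]); [rank_finitary] says that every set contains
   a finite set of the same rank, hence a finite basis. *)
Record matroid (E : Type) := Matroid {
  rank : set E -> nat;
  rank_le_card : forall (n : nat) (X : set E), (X #= `I_n)%card ->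
    (rank X <= n)%N;
  rank_mono : forall X Y : set E, X `<=` Y -> (rank X <= rank Y)%N;
  rank_submod : forall X Y : set E,
    (rank (X `|` Y) + rank (X `&` Y) <= rank X + rank Y)%N;
  rank_finitary : forall X : set E,
    exists Y : set E, [/\ Y `<=` X, finite_set Y & rank Y = rank X]
}.

Definition loopless (E : Type) (M : matroid E) : Prop :=
  forall e : E, rank M [set e] <> 0%N.

Definition flats (E : Type) (M : matroid E) : set (set E) :=
  [set F | forall e : E, ~ F e -> (rank M F < rank M (F `|` [set e]))%N].

Definition is_line (E : Type) (M : matroid E) (l : set E) : Prop :=
  rank M l = 1%N \/ rank M l = 2%N.

(* The entry a(X)_l of the degree vector of [X]; the order of the two tests is
   immaterial because lines are nonempty. *)
Definition degree (E : Type) (X l : set E) : nat :=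
  if `[< X `&` l = set0 >] then 0%N
  else if `[< l `<=` X >] then 2%N
  else 1%N.

(* Linear systems  x >= 0, A x <= b  with nonnegative integer data, in
   variables indexed by a finite type [J] and with rows indexed by a possibly
   infinite type [I]. *)
Section PackingSystems.
Variables (R : realType) (I : choiceType) (J : finType).
Variables (A : I -> J -> nat) (b : I -> nat).

Definition feasible (x : J -> R) : Prop :=
  (forall j, 0 <= x j) /\
  (forall i, \sum_(j : J) (A i j)%:R * x j <= (b i)%:R).

Definition dual_feasible (w : J -> nat) (y : {fsfun I -> R with 0}) : Prop :=
  (forall i, 0 <= y i) /\
  (forall j, (w j)%:R <= \sum_(i <- finsupp y) y i * (A i j)%:R).

Definition dual_value (y : {fsfun I -> R with 0}) : R :=
  \sum_(i <- finsupp y) y i * (b i)%:R.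

Definition dual_optimal (w : J -> nat) (y : {fsfun I -> R with 0}) : Prop :=
  dual_feasible w y /\
  (forall z, dual_feasible w z -> dual_value y <= dual_value z).

Definition half_integral (y : {fsfun I -> R with 0}) : Prop :=
  forall i, exists k : int, y i = k%:~R / 2.

(* Since [A] is nonnegative, replacing the negative entries of a weight vector
   by 0 does not change the dual program; nonnegative weights suffice. *)
Definition half_TDI : Prop :=
  forall w : J -> nat,
    exists y : {fsfun I -> R with 0}, dual_optimal w y /\ half_integral y.

End PackingSystems.

(* The system  x >= 0, a(T) . x <= r(T)  for all flats T  has coefficient
   matrix [matching_coef M L] and right-hand side [matching_rhs M]. *)
Definition matching_coef (E : Type) (M : matroid E) (L : {fset set E})
  (T : flats M) (l : L) : nat := degree (val T) (val l).

Definition matching_rhs (E : Type) (M : matroid E) (T : flats M) : nat :=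
  rank M (val T).

Definition fractional_matching (R : realType) (E : Type) (M : matroid E)
  (L : {fset set E}) : (L -> R) -> Prop :=
  feasible (@matching_coef E M L) (@matching_rhs E M).

(* Main.v *)
(** Call a finite list [s] of flats an [N]-cover of [w] when it meets the dual
    constraints after scaling by [N]; it stands for the dual solution
    [count / N].  Rounding [N y] up to integers turns any real dual solution
    into an [N]-cover whose cost exceeds [N] times its value by a constant
    independent of [N].  On flats, [r] is submodular and every [a(.)_l] is
    supermodular, so the list can be uncrossed into a descending chain
    [D_0, D_1, ...].  On a chain, the flats meeting (resp. containing) [l] form
    an initial segment, and for each [j < N] the subchains of indices congruent
    to [j] and to [N - 1 - j] modulo [N] together form a 2-cover; by averaging
    over [j], one of these costs at most [2 / N] times the whole chain.  Hence a
    cheapest 2-cover, which exists because costs are natural numbers, is an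
    optimal dual solution; no LP duality is needed. *)

Require Import Defs.
From mathcomp Require Import all_boot all_order all_algebra.
From mathcomp Require Import finmap.
From mathcomp Require Import boolp classical_sets cardinality reals.
From mathcomp Require Import zify lra.

Set Implicit Arguments.
Unset Strict Implicit.
Unset Printing Implicit Defensive.

Import Order.TTheory GRing.Theory Num.Theory.

(** * Closure and uncrossing of flats *)

Section Matroid.
Local Open Scope classical_set_scope.
Variables (E : Type) (M : matroid E).
Implicit Types (X Y F G l : set E) (e f : E).

Lemma rank_set0 : rank M set0 = 0.
Proof. by apply/eqP; rewrite -leqn0; apply: rank_le_card; rewrite II0. Qed.

(** Submodularity for [Y] and [X] plus [e], whose intersection contains [X]. *)
Lemma rank_setU1_le X Y e : X `<=` Y ->
  rank M (X `|` [set e]) <= rank M X -> rank M (Y `|` [set e]) <= rank M Y.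
Proof.
move=> sXY rXe; have := rank_submod M Y (X `|` [set e]).
have -> : Y `|` (X `|` [set e]) = Y `|` [set e].
  by rewrite setUA (setUidl sXY).
have : rank M X <= rank M (Y `&` (X `|` [set e])).
  by apply: rank_mono => x Xx; split; [exact: sXY | left].
lia.
Qed.

Lemma flat_mem F X e : flats M F -> X `<=` F ->
  rank M (X `|` [set e]) <= rank M X -> F e.
Proof.
move=> flatF sXF /(rank_setU1_le sXF) rFe; apply: contrapT => /flatF.
by rewrite ltnNge rFe.
Qed.

Lemma flat_setT : flats M setT.
Proof. by move=> e /(_ I). Qed.

Lemma flat_setI F G : flats M F -> flats M G -> flats M (F `&` G).
Proof.
move=> flatF flatG e nFGe; rewrite ltnNge; apply/negP => rFGe; apply: nFGe.
split; first exact: (flat_mem flatF (@subIsetl _ F G) rFGe).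
exact: (flat_mem flatG (@subIsetr _ F G) rFGe).
Qed.

Definition span X : set E := [set e | rank M (X `|` [set e]) <= rank M X].

Lemma sub_span X : X `<=` span X.
Proof. by move=> e Xe; rewrite /span /= (setUidl _) // => _ ->. Qed.

(** Elements of [Y] are added one at a time, hence the finiteness; [rank_span] lifts it by choosing
    a finite subset of full rank. *)
Lemma rank_setU_finite_span X Y :
  finite_set Y -> Y `<=` span X -> rank M (X `|` Y) <= rank M X.
Proof.
case/(@finite_seqP {classic E}) => s ->; elim: s => [|e s IHs] ss.
  by rewrite set_nil setU0.
have -> : X `|` [set` e :: s] = (X `|` [set` s]) `|` [set e].
  apply/seteqP; split=> x /=; rewrite ?inE.
    by move=> [Xx|/orP[/eqP->|sx]]; [left; left | right | left; right].
  by move=> [[Xx|sx]|->]; [left | right; rewrite sx orbT | right; rewrite eqxx].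
apply: leq_trans (IHs _); last by move=> x /= sx; apply: ss; rewrite /= inE sx orbT.
by apply: (@rank_setU1_le X) => [x|]; [left | apply: ss; rewrite /= inE eqxx].
Qed.

Lemma rank_span X : rank M (span X) = rank M X.
Proof.
apply/eqP; rewrite eqn_leq (rank_mono _ (@sub_span X)) andbT.
have [Y [sY finY <-]] := rank_finitary M (span X).
apply: leq_trans (rank_setU_finite_span finY sY).
exact: rank_mono (@subsetUr _ X Y).
Qed.

Lemma flat_span X : flats M (span X).
Proof.
move=> e; rewrite rank_span => /negP; rewrite -ltnNge => /leq_trans; apply.
exact: rank_mono (@setSU _ _ _ _ (@sub_span X)).
Qed.

Lemma span_sub_flat X F : flats M F -> X `<=` F -> span X `<=` F.
Proof. by move=> flatF sXF e; apply: flat_mem. Qed.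

Hypothesis hM : loopless M.

Lemma line_neq0 l : is_line M l -> l !=set0.
Proof. by move=> hl; apply/set0P/eqP => l0; case: hl; rewrite l0 rank_set0. Qed.

(** Take [e] in [F] and [f] in [G], both on [l]. If together they have rank 2, they span [l];
    otherwise, as [e] is not a loop, [f] is in the closure of [e] and so in the flat [F]. *)
Lemma line_sub_span F G l : flats M F -> flats M G -> is_line M l ->
  F `&` l !=set0 -> G `&` l !=set0 ->
  (F `&` G) `&` l !=set0 \/ l `<=` span (F `|` G).
Proof.
move=> flatF flatG hl [e [Fe le]] [f [Gf lf]].
have rl : rank M l <= 2 by case: hl => ->.
have [r2|r1] := leqP 2 (rank M ([set e] `|` [set f])).
  right=> x lx; apply: (@rank_setU1_le ([set e] `|` [set f])).
    by move=> _ [->|->]; [left | right].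
  apply: leq_trans r2; apply: leq_trans rl; apply: rank_mono.
  by move=> _ [[->|->]|->].
left; exists f; split=> //; split=> //.
apply: (@flat_mem _ [set e]) => //; first by move=> _ ->.
by have := @hM e; lia.
Qed.

(** Both indicators are monotone in [X], so on a descending chain each one holds exactly on an
    initial segment; [round_chain] relies on this split. *)
Lemma degreeE X l : l !=set0 ->
  degree X l = `[< X `&` l !=set0 >] + `[< l `<=` X >].
Proof.
move=> [e le]; rewrite /degree; case: asboolP => [Xl0|/eqP/set0P Xl].
  have nXl : ~ (X `&` l !=set0) by rewrite Xl0 => -[].
  by rewrite !asboolF // => slX; apply: nXl; exists e; split; first exact: slX.
by rewrite (asboolT Xl); case: asboolP.
Qed.

(** The critical case is that [F] and [G] both meet [l] and neither contains it: the join
    contributes 1 by meeting [l], and [line_sub_span] supplies the second unit. The other cases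
    follow from monotonicity. *)
Lemma degree_supermod F G l : flats M F -> flats M G -> is_line M l ->
  degree F l + degree G l <= degree (F `&` G) l + degree (span (F `|` G)) l.
Proof.
move=> flatF flatG hl; have l0 := line_neq0 hl; rewrite !degreeE //.
have sF : F `<=` span (F `|` G) by move=> x Fx; apply: sub_span; left.
have sG : G `<=` span (F `|` G) by move=> x Gx; apply: sub_span; right.
have := @line_sub_span F G l flatF flatG hl.
have meet_join X : X `<=` span (F `|` G) -> X `&` l !=set0 ->
    span (F `|` G) `&` l !=set0.
  by move=> sX [x [Xx lx]]; exists x; split; first exact: sX.
have meetF := meet_join _ sF; have meetG := meet_join _ sG.
have subF : l `<=` F -> l `<=` span (F `|` G) by move=> ?; apply: subset_trans sF.
have subG : l `<=` G -> l `<=` span (F `|` G) by move=> ?; apply: subset_trans sG.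
have subFG : l `<=` F -> l `<=` G -> l `<=` F `&` G by move=> ? ? x lx; split; auto.
have sub_meet X : l `<=` X -> X `&` l !=set0.
  by case: l0 => x lx slX; exists x; split; first exact: slX.
have capF : l `<=` F -> G `&` l !=set0 -> (F `&` G) `&` l !=set0.
  by move=> slF [x [Gx lx]]; exists x; split=> //; split=> //; exact: slF.
have capG : l `<=` G -> F `&` l !=set0 -> (F `&` G) `&` l !=set0.
  by move=> slG [x [Fx lx]]; exists x; split=> //; split=> //; exact: slG.
have sub_meetF := sub_meet F; have sub_meetG := sub_meet G.
by do 8!case: asboolP => ? //=; tauto.
Qed.

Definition superflat (F G : flats M) : bool := `[< val G `<=` val F >].

Lemma superflatxx : reflexive superflat.
Proof. by move=> F; apply/asboolP. Qed.

Lemma superflat_trans : transitive superflat.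
Proof.
by move=> G F H /asboolP sGF /asboolP sHG; apply/asboolP; apply: subset_trans sGF.
Qed.

Variables (L : {fset set E}) (hL : forall l, l \in L -> is_line M l).

(** Insertion of [F] into a chain with head [G]: the pair is replaced by its join, which becomes the
    new head, and its meet, which is inserted recursively below [G]. The bound [H] keeps the result
    a chain. *)
Lemma uncross_insert (F H : flats M) (t : seq (flats M)) :
    path superflat H t -> superflat H F ->
  exists u : seq (flats M), [/\ path superflat H u,
    \sum_(G <- u) matching_rhs G <= \sum_(G <- F :: t) matching_rhs G &
    forall l : L, \sum_(G <- F :: t) matching_coef G l <=
                  \sum_(G <- u) matching_coef G l].
Proof.
elim: t F H => [|G t IHt] F H /=.
  by move=> _ sFH; exists [:: F]; split=> //=; rewrite sFH.
case/andP=> /asboolP sGH tP /asboolP sFH.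
have flatF : flats M (val F) := set_mem (valP F).
have flatG : flats M (val G) := set_mem (valP G).
have flatH : flats M (val H) := set_mem (valP H).
pose I : flats M := SigSub (mem_set (flat_setI flatF flatG)).
pose J : flats M := SigSub (mem_set (@flat_span (val F `|` val G))).
have [u [uP rhs_u coef_u]] := IHt I G tP (asboolT (@subIsetr _ _ _)).
exists (J :: u); split.
- rewrite /=; apply/andP; split.
    by apply/asboolP; apply: span_sub_flat => // x [/sFH|/sGH].
  case: u uP {rhs_u coef_u} => //= K u /andP[sKG ->]; rewrite andbT.
  apply: superflat_trans sKG; apply/asboolP => x Gx.
  by apply: sub_span; right.
- rewrite !big_cons in rhs_u *; rewrite addnCA.
  have := rank_submod M (val F) (val G).
  have := rank_span (val F `|` val G).
  move: rhs_u; rewrite /matching_rhs /=; lia.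
- move=> l; have := coef_u l; rewrite !big_cons.
  have := degree_supermod flatF flatG (hL (valP l)).
  rewrite /matching_coef /=; lia.
Qed.

Lemma uncross (s : seq (flats M)) :
  exists t : seq (flats M), [/\ sorted superflat t,
    \sum_(G <- t) matching_rhs G <= \sum_(G <- s) matching_rhs G &
    forall l : L, \sum_(G <- s) matching_coef G l <=
                  \sum_(G <- t) matching_coef G l].
Proof.
(* The ground set serves as an upper bound for every insertion. *)
pose T : flats M := SigSub (mem_set flat_setT).
suff [t [tP rhs_t coef_t]] : exists t : seq (flats M), [/\ path superflat T t,
    \sum_(G <- t) matching_rhs G <= \sum_(G <- s) matching_rhs G &
    forall l : L, \sum_(G <- s) matching_coef G l <=
                  \sum_(G <- t) matching_coef G l].
  by exists t; split=> //; exact: path_sorted tP.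
elim: s => [|F s [t [tP rhs_t coef_t]]]; first by exists [::].
have [u [uP rhs_u coef_u]] := @uncross_insert F T t tP (asboolT (@subsetT _ _)).
exists u; split=> // [|l].
  by apply: leq_trans rhs_u _; rewrite !big_cons leq_add2l.
by apply: leq_trans (coef_u l); rewrite !big_cons leq_add2l.
Qed.

End Matroid.

(** * Counting residues in initial segments *)

Section Residues.

(** The right side is the ceiling of [(a - j) / N], written so that truncated subtraction does no
    harm when [a < j]. *)
Lemma sum_modn_eq (N j a : nat) : j < N ->
  \sum_(i < a) (i %% N == j) = (a + (N.-1 - j)) %/ N.
Proof.
move=> ltjN; have N0 : 0 < N by lia.
elim: a => [|a IHa]; first by rewrite big_ord0 divn_small //; lia.
rewrite big_ord_recr /= {}IHa addSn (divnS _ N0) addnC; congr (_ + _).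
have -> : (a + (N.-1 - j)).+1 = a + N - j by lia.
have -> : (N %| a + N - j) = (a + N == j %[mod N]) by rewrite eqn_mod_dvd; lia.
by rewrite modnDr (modn_small ltjN).
Qed.

Lemma initial_segment (p : pred nat) (m : nat) :
    (forall i k, i <= k -> k < m -> p k -> p i) ->
  exists2 a, a <= m & forall i, i < m -> p i = (i < a).
Proof.
elim: m => [|m IHm] pP; first by exists 0.
have [|a leam aP] := IHm; first by move=> i k leik ltkm; apply: pP; lia.
case pm: (p m).
  by exists m.+1 => // i ltim; rewrite ltim; apply: pP pm; lia.
exists a => [|i]; first lia.
rewrite ltnS leq_eqVlt => /predU1P[->|/aP//].
by rewrite pm ltnNge leam.
Qed.

Lemma sum_initial_segment (p : pred nat) (q : pred nat) (m a : nat) :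
    a <= m -> (forall i, i < m -> p i = (i < a)) ->
  \sum_(i < m | q i) p i = \sum_(i < a) q i.
Proof.
move=> leam pE; rewrite (big_ord_widen m (fun i => q i : nat) leam).
rewrite big_mkcond [RHS]big_mkcond; apply: eq_bigr => i _.
by rewrite pE //; case: (q i); case: (i < a).
Qed.

(** The offsets add up to [N - 1], while the two floors lose at most [2 * (N - 1)]; so [N] times the
    right side is at least [a + b - (N - 1)], which exceeds [N * (w - 1)]. *)
Lemma residue_pair_cover (N j a b w : nat) : j < N -> N * w <= a + b ->
  w <= (a + (N.-1 - j)) %/ N + (b + j) %/ N.
Proof.
move=> ltjN hw; have N0 : 0 < N by lia.
have := ltn_ceil (a + (N.-1 - j)) N0; have := ltn_ceil (b + j) N0.
move: (_ %/ N) (_ %/ N) => p q hp hq; rewrite leqNgt; apply/negP => ltw.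
nia.
Qed.

Lemma exists_le_average (N B : nat) (c : nat -> nat) : 0 < N ->
  \sum_(j < N) c j <= B -> exists2 j, j < N & N * c j <= B.
Proof.
move=> N0 hB; apply: contrapT => hc.
have ltB (j : 'I_N) : B < N * c j.
  by rewrite ltnNge; apply/negP => lecB; apply: hc; exists j.
have : \sum_(j < N) B.+1 <= \sum_(j < N) N * c j by apply: leq_sum => j _.
rewrite sum_nat_const card_ord -big_distrr /= leq_pmul2l //.
by move/leq_trans/(_ hB); rewrite ltnn.
Qed.

End Residues.

(** * Extracting a cheap 2-cover from a chain *)

Section ChainRounding.
Variables (I : eqType) (J : Type) (A : I -> J -> nat) (b : I -> nat).
Variables (r : rel I) (p q : J -> pred I).
Hypotheses (r_refl : reflexive r) (r_trans : transitive r).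
Hypothesis (AE : forall i j, A i j = p j i + q j i).
Hypothesis p_mono : forall j x y, r x y -> p j y -> p j x.
Hypothesis q_mono : forall j x y, r x y -> q j y -> q j x.

Lemma round_chain (N : nat) (w : J -> nat) (t : seq I) : 0 < N -> sorted r t ->
    (forall j, N * w j <= \sum_(i <- t) A i j) ->
  exists u : seq I, (forall j, 2 * w j <= \sum_(i <- u) A i j) /\
    N * \sum_(i <- u) b i <= 2 * \sum_(i <- t) b i.
Proof.
case: t => [|x0 t0] N0 tr hw.
  exists [::]; split=> [j|]; last by rewrite !big_nil !muln0.
  by have := hw j; rewrite !big_nil; nia.
set t := x0 :: t0 in tr hw *; pose m := size t.
pose sub k := [seq nth x0 t i | i <- index_iota 0 m & i %% N == k].
have sumE (f : I -> nat) : \sum_(i <- t) f i = \sum_(i < m) f (nth x0 t i).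
  by rewrite (big_nth x0) big_mkord.
have sum_sub (f : I -> nat) k :
    \sum_(i <- sub k) f i = \sum_(i < m | i %% N == k) f (nth x0 t i).
  by rewrite big_map big_filter big_mkord.
have sum_all (f : I -> nat) :
    \sum_(k < N) \sum_(i <- sub k) f i = \sum_(i <- t) f i.
  rewrite sumE; under eq_bigr do rewrite sum_sub.
  rewrite (exchange_big_dep predT) //=; apply: eq_bigr => i _.
  by rewrite (big_pred1 (Ordinal (ltn_pmod i N0))) //.
(* If [k = N.-1 - k], the same subchain is taken twice. As [k] varies, each class occurs once in
   either role, so the costs [c k] add up to twice that of [t]. *)
pose c k := \sum_(i <- sub k ++ sub (N.-1 - k)) b i.
have [|k ltkN hk] := @exists_le_average N (2 * \sum_(i <- t) b i) c N0.
  under [leqLHS]eq_bigr do rewrite /c big_cat /=.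
  rewrite big_split /= sum_all mul2n -addnn leq_add2l -sum_all.
  rewrite [leqRHS](reindex_inj rev_ord_inj) /=.
  by apply: eq_leq; apply: eq_bigr => j _; congr (\sum_(i <- sub _) _); lia.
exists (sub k ++ sub (N.-1 - k)); split=> // j.
have nth_mono (f : pred I) : (forall x y, r x y -> f y -> f x) ->
    forall i i', i <= i' -> i' < m -> f (nth x0 t i') -> f (nth x0 t i).
  move=> f_mono i i' leii ltm; apply: f_mono.
  by apply: (sorted_leq_nth r_trans r_refl) => //; rewrite inE -/m; lia.
have [al leal alE] := initial_segment (nth_mono _ (p_mono (j := j))).
have [be lebe beE] := initial_segment (nth_mono _ (q_mono (j := j))).
have sumA k' : k' < N -> \sum_(i <- sub k') A i j =
    (al + (N.-1 - k')) %/ N + (be + (N.-1 - k')) %/ N.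
  move=> ltk'; rewrite sum_sub; under eq_bigr do rewrite AE.
  rewrite big_split /= -!sum_modn_eq //; pose res := [pred i | i %% N == k'].
  congr (_ + _); first exact: (sum_initial_segment res leal alE).
  exact: (sum_initial_segment res lebe beE).
have hab : N * w j <= al + be.
  apply: leq_trans (hw j) _; rewrite sumE; under eq_bigr do rewrite AE.
  rewrite big_split /= (sum_initial_segment predT leal alE).
  by rewrite (sum_initial_segment predT lebe beE) !sum_nat_const !card_ord !muln1.
(* The four floors are paired crosswise: [al] with offset [N.-1 - k] goes with [be] with offset [k],
   and vice versa. Each pair is at least [w j]. *)
have hba : N * w j <= be + al by rewrite addnC.
rewrite big_cat /= !sumA //; last lia.
have -> : N.-1 - (N.-1 - k) = k by lia.
have := residue_pair_cover ltkN hab; have := residue_pair_cover ltkN hba.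
lia.
Qed.

End ChainRounding.

(** * Passing between covers and dual solutions *)

Section Covers.
Local Open Scope ring_scope.
Variables (R : realType) (I : choiceType) (J : finType).
Variables (A : I -> J -> nat) (b : I -> nat) (w : J -> nat).

Definition cover (N : nat) (s : seq I) : Prop :=
  forall j, (N * w j <= \sum_(i <- s) A i j)%N.

Definition half_count (s : seq I) : {fsfun I -> R with 0} :=
  [fsfun i in seq_fset tt s => (count_mem i s)%:R / 2 | 0].

Lemma half_countE s i : half_count s i = (count_mem i s)%:R / 2.
Proof.
rewrite fsfunE seq_fsetE; case: ifPn => // /count_memPn ->.
by rewrite mul0r.
Qed.

Lemma sum_half_count s (f : I -> nat) :
  \sum_(i <- finsupp (half_count s)) half_count s i * (f i)%:R =
  (\sum_(i <- s) f i)%N%:R / 2.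
Proof.
have -> : (\sum_(i <- s) f i = \sum_(i <- undup s) count_mem i s * f i)%N.
  rewrite -big_undup_iterop_count; apply: eq_bigr => i _.
  by rewrite Monoid.iteropE iter_addn_0 mulnC.
rewrite (perm_big (undup s)) /=.
  rewrite natr_sum mulr_suml; apply: eq_bigr => i _.
  by rewrite half_countE natrM mulrAC.
apply: uniq_perm; rewrite ?undup_uniq // => i.
rewrite mem_finsupp mem_undup half_countE mulf_eq0 invr_eq0 !pnatr_eq0 orbF.
by rewrite -lt0n -has_count has_pred1.
Qed.

Lemma half_count_feasible s : cover 2 s -> dual_feasible A w (half_count s).
Proof.
move=> hs; split=> [i|j]; first by rewrite half_countE divr_ge0.
rewrite (sum_half_count s (A^~ j)) ler_pdivlMr // -natrM ler_nat mulnC.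
exact: hs.
Qed.

Lemma half_count_half_integral s : half_integral (half_count s).
Proof. by move=> i; exists (count_mem i s)%:Z; rewrite half_countE. Qed.

(** Each [N * z i] is rounded up to a multiplicity [n i]; this adds at most [b i] to the cost, so
    the error term does not depend on [N]. *)
Lemma dual_feasible_cover (z : {fsfun I -> R with 0}) (N : nat) :
    dual_feasible A w z ->
  exists2 s, cover N s & (\sum_(i <- s) b i)%N%:R <=
    N%:R * dual_value b z + \sum_(i <- finsupp z) (b i)%:R.
Proof.
move=> [z0 zw]; pose n i := `|Num.ceil (N%:R * z i)|%N.
have nE i : (n i)%:R = (Num.ceil (N%:R * z i))%:~R :> R.
  rewrite /n natr_absz ger0_norm // ceil_ge0.
  by apply: lt_le_trans (mulr_ge0 (ler0n _ _) (z0 i)); rewrite ltrN10.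
have n_ge i : N%:R * z i <= (n i)%:R by rewrite nE ceil_ge.
have n_le i : (n i)%:R <= N%:R * z i + 1.
  by rewrite nE; have := ceil_itv (N%:R * z i); rewrite intrB; lra.
pose s := flatten [seq nseq (n i) i | i <- finsupp z].
have sumE (f : I -> nat) :
    (\sum_(i <- s) f i)%N = (\sum_(i <- finsupp z) n i * f i)%N.
  rewrite big_flatten /= big_map; apply: eq_bigr => i _.
  by rewrite big_nseq iter_addn_0 mulnC.
exists s => [j|].
  rewrite -(ler_nat R) sumE natr_sum natrM.
  apply: le_trans (ler_wpM2l (ler0n _ _) (zw j)) _.
  rewrite mulr_sumr; apply: ler_sum => i _; rewrite natrM mulrA.
  by rewrite ler_wpM2r.
rewrite sumE natr_sum /dual_value mulr_sumr -big_split /=.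
apply: ler_sum => i _; rewrite natrM mulrA -[X in _ + X]mul1r -mulrDl.
by rewrite ler_wpM2r.
Qed.

End Covers.

(** * Optimality of a cheapest 2-cover *)

Local Open Scope ring_scope.

Lemma half_TDI_of_covers (R : realType) (I : choiceType) (J : finType)
    (A : I -> J -> nat) (b : I -> nat) :
    (forall w, exists s, cover A w 2 s) ->
    (forall w N s, (0 < N)%N -> cover A w N s -> exists2 s', cover A w 2 s' &
       (N * \sum_(i <- s') b i <= 2 * \sum_(i <- s) b i)%N) ->
  half_TDI R A b.
Proof.
move=> cover_ex cover_round w.
pose P c := `[< exists2 s, cover A w 2 s & (\sum_(i <- s) b i)%N = c >].
have exP : exists c, P c.
  by have [s hs] := cover_ex w; exists (\sum_(i <- s) b i)%N; apply/asboolP; exists s.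
case: (ex_minnP exP) => c /asboolP[s hs sE] c_min.
exists (half_count R s); split; last exact: half_count_half_integral.
split=> [|z hz]; first exact: half_count_feasible.
rewrite /dual_value (sum_half_count R s b) sE -/(dual_value b z).
set K := \sum_(i <- finsupp z) (b i)%:R : R.
(* Round [z] to an [N]-cover, then that to a 2-cover, whose cost is at least [c]. As [K] is fixed, a
   positive gap would fail for [N] beyond [K / d]. *)
have bound N : (0 < N)%N -> N%:R * (c%:R / 2 - dual_value b z) <= K.
  move=> N0; have [u hu ub] := dual_feasible_cover b N hz.
  have [u' hu' u'b] := cover_round w N u N0 hu.
  have : (N * c <= 2 * \sum_(i <- u) b i)%N.
    apply: leq_trans u'b; rewrite leq_mul2l c_min ?orbT //.
    by apply/asboolP; exists u'.
  rewrite -(ler_nat R) !natrM; move: ub; rewrite -/K; lra.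
rewrite leNgt; apply/negP => gap; set d := c%:R / 2 - dual_value b z in bound.
have d0 : 0 < d by rewrite subr_gt0.
have K0 : 0 <= K / d by rewrite divr_ge0 ?(ltW d0) // sumr_ge0.
have := bound (Num.bound (K / d)).+1 isT.
rewrite -ler_pdivlMr // leNgt => /negP; apply.
by apply: lt_trans (archi_boundP K0) _; rewrite ltr_nat.
Qed.

Theorem theorem1 (R : realType) (E : Type) (M : matroid E)
  (L : {fset set E}) (hM : loopless M)
  (hL : forall l : set E, l \in L -> is_line M l) :
  half_TDI R (@matching_coef E M L) (@matching_rhs E M).
Proof.
apply: half_TDI_of_covers => [w|w N s N0 hs].
  (* The ground set has degree 2 on every line, so repeating it as often as the total weight gives a
     2-cover. *)
  pose T : flats M := SigSub (mem_set (@flat_setT E M)).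
  exists (nseq (\sum_l w l)%N T) => l.
  rewrite big_nseq iter_addn_0 /matching_coef degreeE; last first.
    exact: line_neq0 (hL _ (valP l)).
  have [x lx] := line_neq0 (hL _ (valP l)).
  rewrite !asboolT //; last by exists x.
  by rewrite leq_mul2l (bigD1 l) //= leq_addr.
have [t [t_chain rhs_t coef_t]] := uncross hM hL s.
have [||||||u [hu ub]] := @round_chain (flats M) L (@matching_coef E M L)
  (@matching_rhs E M) (@superflat E M)
  (fun l F => `[< val F `&` val l !=set0 >]%classic)
  (fun l F => `[< val l `<=` val F >]%classic) _ _ _ _ _ N w t N0 t_chain.
- exact: superflatxx.
- exact: superflat_trans.
- by move=> F l; apply: degreeE; exact: line_neq0 (hL _ (valP l)).
- move=> l F G /asboolP sGF /asboolP[x [Gx lx]]; apply/asboolP; exists x.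
  by split; first exact: sGF.
- move=> l F G /asboolP sGF /asboolP slG; apply/asboolP.
  exact: subset_trans sGF.
- by move=> l; apply: leq_trans (hs l) (coef_t l).
exists u => //; apply: leq_trans ub _; rewrite leq_mul2l.
exact: rhs_t.
Qed.
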